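(* Let $(A+\gamma I),(B+\mu I)\in\mathscr{PC}_2(\mathcal{H})$. Let $\alpha>0,\beta>0$ be fixed. Let $p,q\in\mathbb{R}$ be such that $p\alpha(\gamma/\mu)^p=q\beta(\gamma/\mu)^{-q}$. Then for $\Lambda+\frac{\gamma}{\mu}I=(B+\mu I)^{-1/2}(A+\gamma I)(B+\mu I)^{-1/2}$, $$\frac{\alpha(\Lambda+\frac{\gamma}{\mu}I)^p+\beta(\Lambda+\frac{\gamma}{\mu}I)^{-q}}{\alpha+\beta}\in\mathscr{PC}_1(\mathcal{H}).$$
   Context: $\mathcal{H}$ is a real separable Hilbert space with $\dim\mathcal{H}=\infty$, $I$ its identity operator; $\mathrm{Tr}(\mathcal{H})$ and $\mathrm{HS}(\mathcal{H})$ are the trace class and Hilbert-Schmidt operators on $\mathcal{H}$. An operator $T$ is positive definite, $T>0$, if $T=T^*$ and there is $M>0$ with $\langle x,Tx\rangle\ge M\|x\|^2$ for all $x\in\mathcal{H}$. $\mathscr{PC}_1(\mathcal{H})=\{A+\gamma I>0:A=A^*,A\in\mathrm{Tr}(\mathcal{H}),\gamma\in\mathbb{R}\}$ and $\mathscr{PC}_2(\mathcal{H})=\{A+\gamma I>0:A=A^*,A\in\mathrm{HS}(\mathcal{H}),\gamma\in\mathbb{R}\}$ (necessarily $\gamma>0$ in both). For $P\in\mathscr{PC}_2(\mathcal{H})$, $\log P$ is defined by the spectral calculus and $P^s=\exp(s\log P)\in\mathscr{PC}_2(\mathcal{H})$ for $s\in\mathbb{R}$. In the claim $\Lambda\in\mathrm{HS}(\mathcal{H})$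 and $\Lambda+\frac{\gamma}{\mu}I\in\mathscr{PC}_2(\mathcal{H})$. *)

(* Defs.v *)
From HB Require Import structures.
From mathcomp Require Import all_boot all_order all_algebra.
From mathcomp Require Import all_classical all_reals all_analysis.

Set Implicit Arguments.
Unset Strict Implicit.
Unset Printing Implicit Defensive.

Import Order.TTheory GRing.Theory Num.Theory.
Import numFieldNormedType.Exports.

Local Open Scope classical_set_scope.
Local Open Scope ring_scope.

(* A real Hilbert space is a complete normed module [H] over a [realType],
   together with an inner product [ip] that induces its norm. *)
Definition induces_norm (R : realType) (H : completeNormedModType R)
    (ip : {dot H for idfun}) : Prop :=
  forall x : H, `|x| ^+ 2 = ip x x.

Definition separable_space (T : topologicalType) : Prop :=
  exists2 D : set T, countable D & dense D.

Definition infinite_dimensional (R : realType) (V : lmodType R) : Prop :=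
  ~ exists (n : nat) (v : 'I_n -> V),
      forall x : V, exists c : 'I_n -> R, x = \sum_(i < n) c i *: v i.

Section Operators.
Variables (R : realType) (H : completeNormedModType R).
Variable ip : {dot H for idfun}.
Implicit Types (T S P A : H -> H) (e : nat -> H).

(* Operators are bare functions; each class of operators below includes
   [bounded_operator]. *)
Definition bounded_operator T : Prop := linear T /\ continuous T.

Definition adjoint_of T S : Prop := forall x y, ip (T x) y = ip x (S y).

Definition self_adjoint T : Prop := bounded_operator T /\ adjoint_of T T.

Definition positive_semidefinite T : Prop :=
  self_adjoint T /\ forall x, 0 <= ip x (T x).

Definition positive_definite T : Prop :=
  self_adjoint T /\
  exists2 M : R, 0 < M & forall x, M * `|x| ^+ 2 <= ip x (T x).

(* Indexing by [nat] is no restriction on a separable infinite-dimensional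
   space. *)
Definition orthonormal_basis e : Prop :=
  (forall i j, ip (e i) (e j) = (i == j)%:R) /\
  (forall x, series (fun k => ip (e k) x *: e k) @ \oo --> x).

Definition hilbert_schmidt T : Prop :=
  bounded_operator T /\
  exists2 e, orthonormal_basis e & cvgn (series (fun k => `|T (e k)| ^+ 2)).

(* [S] is the absolute value (T^* T)^(1/2), i.e. the positive square root
   of T^* T. *)
Definition absolute_value_of T S : Prop :=
  positive_semidefinite S /\
  exists2 T', adjoint_of T T' & forall x, S (S x) = T' (T x).

Definition trace_class T : Prop :=
  bounded_operator T /\
  exists S, absolute_value_of T S /\
  exists2 e, orthonormal_basis e & cvgn (series (fun k => ip (e k) (S (e k)))).

(* A + g I *)
Definition add_scalar A (g : R) : H -> H := fun x => A x + g *: x.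

Definition PC1 : set (H -> H) := [set T | exists A (g : R),
  [/\ trace_class A, self_adjoint A, T = add_scalar A g
    & positive_definite T]].

Definition PC2 : set (H -> H) := [set T | exists A (g : R),
  [/\ hilbert_schmidt A, self_adjoint A, T = add_scalar A g
    & positive_definite T]].

Definition eigen_decomposition P (d : (nat -> H) * (nat -> R)) : Prop :=
  orthonormal_basis d.1 /\ forall k, P (d.1 k) = d.2 k *: d.1 k.

(* f(P) = sum_k f(l_k) (e_k (x) e_k), where (e_k) is an orthonormal basis of
   eigenvectors of P and P e_k = l_k e_k; on each eigenspace f(P) is the
   corresponding scalar, so a bounded f(P) does not depend on the chosen basis.
   Every element of [PC2] has such a basis, as a self-adjoint compact operator
   plus a multiple of I; for an operator without one the value is junk. *)
Definition spectral_calculus (f : R -> R) P : H -> H :=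
  let d := xget (fun=> 0, fun=> 0) [set d | eigen_decomposition P d] in
  fun x => limn (series (fun k => (f (d.2 k) * ip (d.1 k) x) *: d.1 k)).

Definition op_log P : H -> H := spectral_calculus (@ln R) P.

(* For bounded T the exponential series converges in operator norm, hence its
   sum is its pointwise limit. *)
Definition op_exp T : H -> H :=
  fun x => limn (series (fun k => (k`!%:R)^-1 *: iter k T x)).

Definition op_pow P (s : R) : H -> H := op_exp (fun x => s *: op_log P x).

End Operators.

(* Main.v *)
(* A self-adjoint Hilbert-Schmidt operator has an orthonormal eigenbasis, and
   the sum of the [`|T e_k| ^+ 2] does not depend on the orthonormal basis
   [(e_k)]. In an eigenbasis of [B], with [(B + mu) f_k = b_k f_k], the vector
   [Lambda f_k] is bounded by [A f_k] and [b_k - mu]; so [Lambda] is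
   Hilbert-Schmidt. Let [t_k] be the eigenvalues of [Lambda + nu I], where
   [nu = gamma / mu]. The mean is diagonal in the same basis, with entries
   [F(t_k)], and the condition on [p] and [q] says exactly that [F'(nu) = 0];
   so [F(t_k) - F(nu)] is quadratic in [t_k - nu], hence summable.

   For the spectral theorem: a maximizing sequence of [`|T x|] on the unit
   sphere of the orthogonal complement of some eigenvectors has a weak limit
   along an ultrafilter, and [T] sends it to a norm limit, so the supremum [m]
   is attained at some [x]; then [T (T x) = m ^+ 2 *: x], and [x] or
   [T x + m *: x] is an eigenvector. *)

From HB Require Import structures.
Require Import Defs.
From mathcomp Require Import all_boot all_order all_algebra.
From mathcomp Require Import all_classical all_reals all_analysis.
From mathcomp Require Import ring lra.
Import Order.TTheory GRing.Theory Num.Theory.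
Import numFieldNormedType.Exports.
Local Open Scope classical_set_scope.
Local Open Scope ring_scope.

Set Implicit Arguments.
Unset Strict Implicit.

(** * Inner products and orthonormal bases *)

Section InnerProduct.
Variables (R : realType) (H : completeNormedModType R) (ip : {dot H for idfun}).
Hypothesis hip : induces_norm ip.
Implicit Types (x y z : H) (a b : R).

Lemma ipC x y : ip x y = ip y x.
Proof. by rewrite hermC /= expr0 mul1r. Qed.

Lemma ipDl x y z : ip (x + y) z = ip x z + ip y z. Proof. exact: linearDl. Qed.

Lemma ipDr x y z : ip z (x + y) = ip z x + ip z y. Proof. exact: linearDr. Qed.

Lemma ipBl x y z : ip (x - y) z = ip x z - ip y z. Proof. exact: linearBl. Qed.

Lemma ipBr x y z : ip z (x - y) = ip z x - ip z y. Proof. exact: linearBr. Qed.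

Lemma ipZl a x z : ip (a *: x) z = a * ip x z. Proof. exact: linearZl_LR. Qed.

Lemma ipZr a x z : ip z (a *: x) = a * ip z x. Proof. exact: linearZr_LR. Qed.

Lemma ip0r z : ip z 0 = 0. Proof. exact: linear0r. Qed.

Lemma ip_suml (I : Type) (r : seq I) (P : pred I) (F : I -> H) z :
  ip (\sum_(i <- r | P i) F i) z = \sum_(i <- r | P i) ip (F i) z.
Proof. exact: linear_sumlz. Qed.

Lemma ip_sumr (I : Type) (r : seq I) (P : pred I) (F : I -> H) z :
  ip z (\sum_(i <- r | P i) F i) = \sum_(i <- r | P i) ip z (F i).
Proof. exact: linear_sumr. Qed.

Lemma cauchy_schwarz x y : `|ip x y| <= `|x| * `|y|.
Proof.
have [->|y0] := eqVneq y 0; first by rewrite ip0r !normr0 mulr0.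
rewrite -(@ler_pXn2r _ 2) ?nnegrE ?mulr_ge0//.
rewrite real_normK ?num_real// exprMn !hip.
have yy : 0 < ip y y by rewrite -hip exprn_gt0 ?normr_gt0.
(* This vector is [ip y y] times the component of [x] orthogonal to [y]; its squared norm is
   [ip y y] times the Gram determinant of [x] and [y]. *)
have : 0 <= `|ip y y *: x - ip x y *: y| ^+ 2 by [].
rewrite hip ipBl !ipBr !ipZl !ipZr (ipC y x) => h.
rewrite -(ler_pM2l yy) -subr_ge0; apply: le_trans h _.
by rewrite le_eqVlt; apply/orP; left; apply/eqP; ring.
Qed.

Lemma cvg_ipr (T : Type) (F : set_system T) {FF : Filter F} (u : T -> H) z y :
  u @ F --> y -> (fun t => ip z (u t)) @ F --> ip z y.
Proof.
move=> uy; apply/cvgrPdist_le => e e0.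
have [d d0 de] : exists2 d, 0 < d & `|z| * d <= e.
  exists (e / (`|z| + 1)); first by rewrite divr_gt0// ltr_wpDl.
  rewrite mulrA ler_pdivrMr ?ltr_wpDl// mulrC ler_wpM2l ?ltW//.
  by rewrite ltrDl.
move/cvgrPdist_le : uy => /(_ d d0); apply: filterS => t ht.
rewrite -ipBr (le_trans (cauchy_schwarz _ _))// (le_trans _ de)//.
by rewrite ler_wpM2l.
Qed.

Lemma norm_le_sqr (x y : H) a : 0 <= a -> `|x| ^+ 2 <= a ^+ 2 * `|y| ^+ 2 ->
  `|x| <= a * `|y|.
Proof. by move=> a0; rewrite -exprMn ler_pXn2r ?nnegrE ?mulr_ge0. Qed.

End InnerProduct.

Arguments cvg_ipr {R H ip} hip {T F FF u} z {y}.

Lemma cvgn_series_nneg (R : realType) (u : nat -> R) (M : R) :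
  (forall k, 0 <= u k) -> (forall n, \sum_(0 <= k < n) u k <= M) ->
  cvgn (series u).
Proof.
move=> u0 uM; apply: nondecreasing_is_cvgn.
  by apply/nondecreasing_seqP => n; rewrite seriesSr lerDl.
by exists M => _ [n _ <-]; exact: uM.
Qed.

Lemma cvgn_series_nneg_le (R : realType) (u : nat -> R) :
  (forall k, 0 <= u k) -> cvgn (series u) ->
  exists M, forall n, \sum_(0 <= k < n) u k <= M.
Proof.
move=> u0 cu; exists (limn (series u)) => n.
apply: (nondecreasing_cvgn_le _ cu).
by apply/nondecreasing_seqP => m; rewrite seriesSr lerDl.
Qed.

Lemma series_nneg_tail (R : realType) (u : nat -> R) (M e : R) :
  (forall k, 0 <= u k) -> (forall n, \sum_(0 <= k < n) u k <= M) -> 0 < e ->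
  exists N, forall m n, (N <= m)%N -> \sum_(m <= k < n) u k <= e.
Proof.
move=> u0 uM e0; have cu := cvgn_series_nneg u0 uM.
have /cauchy_seriesP/(_ e e0) : cauchy (series u @ \oo) by exact: cvg_cauchy.
(* The Cauchy property gives separate neighbourhoods of infinity for the two ends of a block, hence
   the maximum of two thresholds. *)
move=> [[P Q]/= [[N1 _ HP] [N2 _ HQ]] PQ].
exists (maxn N1 N2) => m n; rewrite geq_max => /andP[m1 m2].
have [nm|mn] := leqP n m; first by rewrite big_geq// ltW.
have /PQ/= : (P `*` Q) (m, n).
  by split => /=; [exact: HP|apply: HQ => /=; rewrite (leq_trans m2)// ltnW].
by rewrite ger0_norm ?sumr_ge0// => /ltW.
Qed.

Section OrthonormalSequences.
Variables (R : realType) (H : completeNormedModType R) (ip : {dot H for idfun}).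
Hypothesis hip : induces_norm ip.
Variable f : nat -> H.
Hypothesis fON : forall i j, ip (f i) (f j) = (i == j)%:R.
Implicit Types (x y z : H) (c : nat -> R).

Lemma ip_orthonormal_sum c m n j :
  ip (f j) (\sum_(m <= k < n) c k *: f k) = if (m <= j < n)%N then c j else 0.
Proof.
rewrite ip_sumr; under eq_bigr do rewrite ipZr fON.
case: ifPn => jmn.
  rewrite (bigD1_seq j)/= ?mem_index_iota ?iota_uniq// eqxx mulr1.
  rewrite big1 ?addr0// => k kj.
  by rewrite eq_sym (negbTE kj) mulr0.
rewrite big_nat big1// => k kmn.
by case: eqP jmn => [->|]; rewrite ?kmn// mulr0.
Qed.

Lemma pythagoras c m n :
  `|\sum_(m <= k < n) c k *: f k| ^+ 2 = \sum_(m <= k < n) c k ^+ 2.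
Proof.
rewrite hip {1}ip_suml [RHS]big_nat [LHS]big_nat; apply: eq_bigr => k kmn.
by rewrite ipZl ip_orthonormal_sum kmn expr2.
Qed.

Lemma bessel x n : \sum_(0 <= k < n) ip (f k) x ^+ 2 <= `|x| ^+ 2.
Proof.
(* [s] is the orthogonal projection of [x] on the first [n] vectors, so that
   [|x - s|^2 = |x|^2 - |s|^2]. *)
set s := \sum_(0 <= k < n) ip (f k) x *: f k.
have sx : ip s x = \sum_(0 <= k < n) ip (f k) x ^+ 2.
  by rewrite /s ip_suml; apply: eq_bigr => k _; rewrite ipZl expr2.
have : 0 <= `|x - s| ^+ 2 by [].
rewrite hip ipBl !ipBr (ipC _ x s) sx -!hip (pythagoras (fun k => ip (f k) x)).
by rewrite subrr subr0 subr_ge0.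
Qed.

(** By Pythagoras a block of the vector series has as squared norm the same block of the sum of
    squares, so the partial sums are Cauchy and completeness applies. *)
Lemma riesz_fischer c (M : R) :
  (forall n, \sum_(0 <= k < n) c k ^+ 2 <= M) ->
  cvgn (series (fun k => c k *: f k)).
Proof.
move=> cM; apply/cauchy_cvgP/cauchy_seriesP => e e0.
have e2 : 0 < (e / 2) ^+ 2 by rewrite exprn_gt0// divr_gt0.
have [N hN] := series_nneg_tail (fun k => sqr_ge0 (c k)) cM e2.
exists ([set n | (N <= n)%N], setT) => /=.
  by split; [exists N|exact: filterT].
move=> [m n]/= [Nm _].
have /(hN _ n) : (N <= m)%N by [].
rewrite -pythagoras ler_pXn2r ?nnegrE ?divr_ge0 ?(ltW e0)// => h.
by rewrite (le_lt_trans h)// ltr_pdivrMr// ltr_pMr// ltr1n.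
Qed.

Lemma ip_lim_series c j : cvgn (series (fun k => c k *: f k)) ->
  ip (f j) (limn (series (fun k => c k *: f k))) = c j.
Proof.
move=> cu; have h : ip (f j) \o series (fun k => c k *: f k) @ \oo -->
    ip (f j) (limn (series (fun k => c k *: f k))).
  exact: cvg_ipr cu.
rewrite -(cvg_lim (@Rhausdorff R) h).
apply: (cvg_lim (@Rhausdorff R)); apply: cvg_near_cst.
(* From index [j.+1] on, the partial sums contain the term [j], and their coordinate along [f j] is
   constant. *)
exists j.+1 => // n /= jn.
by rewrite /series/= ip_orthonormal_sum leq0n jn.
Qed.

End OrthonormalSequences.

Section OrthonormalBases.
Variables (R : realType) (H : completeNormedModType R) (ip : {dot H for idfun}).
Hypothesis hip : induces_norm ip.
Variable f : nat -> H.
Hypothesis fB : orthonormal_basis ip f.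
Implicit Types (x y z : H).

Lemma cvg_parseval x y :
  series (fun k => ip (f k) x * ip (f k) y) @ \oo --> ip x y.
Proof.
have -> : series (fun k => ip (f k) x * ip (f k) y) =
    ip y \o series (fun k => ip (f k) x *: f k).
  apply/funext => n; rewrite /series/= ip_sumr.
  by apply: eq_bigr => k _; rewrite ipZr (ipC _ y).
by rewrite (ipC _ x); exact: cvg_ipr (fB.2 x).
Qed.

Lemma cvg_parseval_norm x : series (fun k => ip (f k) x ^+ 2) @ \oo --> `|x| ^+ 2.
Proof. by rewrite hip; exact: cvg_parseval. Qed.

Lemma onb_norm k : `|f k| = 1.
Proof. by apply/eqP; rewrite -(@pexpr_eq1 _ _ 2)// hip fB.1 eqxx. Qed.

Lemma onb_ext x y : (forall k, ip (f k) x = ip (f k) y) -> x = y.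
Proof.
move=> xy; have := fB.2 x.
have -> : (fun k => ip (f k) x *: f k) = (fun k => ip (f k) y *: f k).
  by apply/funext => k; rewrite xy.
by move=> h; rewrite -(cvg_lim _ h)// -[RHS](cvg_lim _ (fB.2 y)).
Qed.

(** The two Parseval sums are compared term by term. Norm estimates for diagonal operators reduce to
    scalar ones this way. *)
Lemma norm_le_coord x z (d : R) : 0 <= d ->
  (forall k, `|ip (f k) z| <= d * `|ip (f k) x|) -> `|z| <= d * `|x|.
Proof.
move=> d0 zx; apply: norm_le_sqr => //.
have h : d ^+ 2 *: series (fun k => ip (f k) x ^+ 2) @ \oo --> d ^+ 2 * `|x| ^+ 2.
  by apply: cvgZr; exact: cvg_parseval_norm.
apply: (ler_cvg_to _ h); first exact: cvg_parseval_norm.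
apply: nearW => n; rewrite /series/=.
rewrite (_ : (_ *: _) n = d ^+ 2 * \sum_(0 <= k < n) ip (f k) x ^+ 2)//.
rewrite mulr_sumr; apply: ler_sum => k _.
rewrite -[_ ^+ 2]real_normK ?num_real// -[ip (f k) x ^+ 2]real_normK ?num_real//.
by rewrite -exprMn ler_pXn2r ?nnegrE ?mulr_ge0.
Qed.

End OrthonormalBases.

Arguments cvg_parseval {R H ip} hip {f} fB x y.
Arguments cvg_parseval_norm {R H ip} hip {f} fB x.

Section BoundedOperators.
Variables (R : realType) (H : completeNormedModType R).
Implicit Types T : H -> H.

Lemma bounded_operatorP T : linear T ->
  continuous T <-> exists2 K : R, 0 < K & forall x, `|T x| <= K * `|x|.
Proof.
move=> linT.
pose L : {linear H -> H} := HB.pack T (GRing.isLinear.Build _ _ _ _ T linT).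
have -> : continuous T <-> bounded_near L (nbhs (0 : H)).
  by rewrite linear_bounded_continuous.
split=> [/linear_boundedP[M [_ hM]]|[K K0 hK]].
  exists (`|M| + 1) => [|x]; first by rewrite ltr_wpDl.
  by apply: hM; rewrite (le_lt_trans (ler_norm M))// ltrDl.
apply/linear_boundedP; exists K; split; first exact: gtr0_real.
by move=> k Kk x; rewrite (le_trans (hK x))// ler_wpM2r// ltW.
Qed.

Lemma linear_opP T : linear T ->
  [/\ forall x y, T (x + y) = T x + T y, forall x y, T (x - y) = T x - T y,
   forall a x, T (a *: x) = a *: T x & T 0 = 0].
Proof.
move=> linT.
pose L : {linear H -> H} := HB.pack T (GRing.isLinear.Build _ _ _ _ T linT).
split=> [x y|x y|a x|]; [exact: (linearD L)|exact: (linearB L)| |].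
  exact: (linearZ_LR L).
exact: (linear0 L).
Qed.

End BoundedOperators.

(** * Diagonal operators and powers *)

(** The series is that of [spectral_calculus] with basis and entries made explicit, so that [op_log]
    is a [diag] by conversion. *)
Definition diag (R : realType) (H : completeNormedModType R)
    (ip : {dot H for idfun}) (f : nat -> H) (d : nat -> R) : H -> H :=
  fun x => limn (series (fun k => (d k * ip (f k) x) *: f k)).

Section Diagonal.
Variables (R : realType) (H : completeNormedModType R) (ip : {dot H for idfun}).
Hypothesis hip : induces_norm ip.
Variable f : nat -> H.
Hypothesis fB : orthonormal_basis ip f.
Variables (d : nat -> R) (D : R).
Hypothesis dD : forall k, `|d k| <= D.
Implicit Types x y z : H.

Let D0 : 0 <= D. Proof. exact: le_trans (dD 0%N). Qed.

Lemma ip_diag k x : ip (f k) (diag ip f d x) = d k * ip (f k) x.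
Proof.
rewrite (ip_lim_series hip fB.1 (c := fun k => d k * ip (f k) x))//.
(* The coefficients are square-summable by Bessel's inequality, since the entries are bounded by
   [D]. *)
apply: (riesz_fischer hip fB.1 (M := D ^+ 2 * `|x| ^+ 2)) => n.
rewrite (@le_trans _ _ (\sum_(0 <= k < n) D ^+ 2 * ip (f k) x ^+ 2))//.
  apply: ler_sum => i _; rewrite exprMn ler_wpM2r ?sqr_ge0//.
  by rewrite -real_normK ?num_real// ler_pXn2r ?nnegrE.
by rewrite -mulr_sumr ler_wpM2l ?sqr_ge0// (bessel hip fB.1).
Qed.

Lemma diag_linear : linear (diag ip f d).
Proof.
move=> a x y; apply: (onb_ext fB) => k.
by rewrite ip_diag !(ipDr, ipZr) !ip_diag mulrDr mulrCA.
Qed.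

Lemma diag_norm_le x : `|diag ip f d x| <= D * `|x|.
Proof.
apply: (norm_le_coord hip fB) => // k.
by rewrite ip_diag normrM ler_wpM2r.
Qed.

Lemma diag_bounded_operator : bounded_operator (diag ip f d).
Proof.
split; first exact: diag_linear.
apply/(bounded_operatorP diag_linear); exists (D + 1) => [|x].
  by rewrite ltr_wpDl.
by rewrite (le_trans (diag_norm_le x))// ler_wpM2r// lerDl.
Qed.

Lemma diag_self_adjoint : self_adjoint ip (diag ip f d).
Proof.
split=> [|x y]; first exact: diag_bounded_operator.
rewrite -(cvg_lim (@Rhausdorff R) (cvg_parseval hip fB (diag ip f d x) y)).
rewrite -(cvg_lim (@Rhausdorff R) (cvg_parseval hip fB x (diag ip f d y))).
congr (limn (series _)); apply/funext => k.
by rewrite !ip_diag mulrCA !mulrA.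
Qed.

Lemma diag_ge (m : R) x : (forall k, m <= d k) ->
  m * `|x| ^+ 2 <= ip x (diag ip f d x).
Proof.
move=> md.
have h : m *: series (fun k => ip (f k) x ^+ 2) @ \oo --> m * `|x| ^+ 2.
  by apply: cvgZr; exact: cvg_parseval_norm.
apply: (ler_cvg_to h (cvg_parseval hip fB x (diag ip f d x))).
apply: nearW => n; rewrite /series/=.
rewrite (_ : (_ *: _) n = m * \sum_(0 <= k < n) ip (f k) x ^+ 2)//.
rewrite mulr_sumr; apply: ler_sum => k _.
by rewrite ip_diag expr2 [leRHS]mulrCA ler_wpM2r -?expr2 ?sqr_ge0.
Qed.

Lemma diag_basis k : diag ip f d (f k) = d k *: f k.
Proof.
apply: (onb_ext fB) => j; rewrite ip_diag ipZr fB.1.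
by case: eqP => [->|]//; rewrite !mulr0.
Qed.

End Diagonal.

(** The tail of the series at [t] is dominated termwise by the tail at [K]. The bound is uniform in
    [t], hence uniform over a bounded family of eigenvalues. *)
Lemma expR_partial_sum_le (R : realType) (t K : R) (n : nat) : `|t| <= K ->
  `|series (exp_coeff t) n - expR t| <= expR K - series (exp_coeff K) n.
Proof.
move=> tK.
have ct := is_cvg_series_exp_coeff t.
have cK := is_cvg_series_exp_coeff K.
have h1 : `|series (exp_coeff t) n - series (exp_coeff t) m| @[m --> \oo]
    --> `|series (exp_coeff t) n - expR t|.
  by apply: cvg_norm; apply: cvgB => //; exact: cvg_cst.
have h2 : series (exp_coeff K) m - series (exp_coeff K) n @[m --> \oo]
    --> expR K - series (exp_coeff K) n.
  by apply: cvgB => //; exact: cvg_cst.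
apply: (ler_cvg_to h1 h2); exists n => // m /= nm.
rewrite distrC !sub_series nm (le_trans (ler_norm_sum _ _ _))//.
apply: ler_sum => k _; rewrite /exp_coeff/= normrM normrX normfV.
rewrite (ger0_norm (ler0n _ _)) ler_wpM2r ?invr_ge0//.
by rewrite lerXn2r ?nnegrE ?(le_trans _ tK).
Qed.

Lemma ln_norm_le (R : realType) (c t K : R) : 0 < c -> c <= t <= K ->
  `|ln t| <= Num.max `|ln c| `|ln K|.
Proof.
move=> c0 /andP[ct tK]; have t0 := lt_le_trans c0 ct.
have K0 := lt_le_trans t0 tK.
rewrite ler_norml; apply/andP; split.
  rewrite lerNl; apply: (@le_trans _ _ `|ln c|); last by rewrite le_max lexx.
  rewrite -normrN; apply: le_trans (ler_norm _).
  by rewrite lerN2 ler_ln ?posrE.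
apply: (@le_trans _ _ `|ln K|); last by rewrite le_max lexx orbT.
by apply: le_trans (ler_norm _); rewrite ler_ln ?posrE.
Qed.

Section Powers.
Variables (R : realType) (H : completeNormedModType R) (ip : {dot H for idfun}).
Hypothesis hip : induces_norm ip.

(** On the coordinate [k] the operator series is the scalar series of [expR (s * d k)]. The
    remainders are bounded uniformly in [k], so the coordinatewise limit is a limit in norm. *)
Lemma op_exp_diag (f : nat -> H) (d : nat -> R) (D s : R) :
  orthonormal_basis ip f -> (forall k, `|d k| <= D) ->
  op_exp (fun x => s *: diag ip f d x) = diag ip f (fun k => expR (s * d k)).
Proof.
move=> fB dD; apply/funext => x; rewrite /op_exp.
set K := `|s| * D.
have dK k : `|s * d k| <= K by rewrite normrM ler_wpM2l.
have eK k : `|expR (s * d k)| <= expR K.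
  by rewrite ger0_norm ?expR_ge0// ler_expR (le_trans (ler_norm _)).
have iterE n k : ip (f k) (iter n (fun x => s *: diag ip f d x) x)
    = (s * d k) ^+ n * ip (f k) x.
  elim: n => [|n IH]; first by rewrite expr0 mul1r.
  by rewrite iterS ipZr (ip_diag hip fB dD) IH exprS !mulrA.
have serE n k : ip (f k)
    (series (fun k => (k`!%:R)^-1 *: iter k (fun x => s *: diag ip f d x) x) n)
    = series (exp_coeff (s * d k)) n * ip (f k) x.
  rewrite /series/= ip_sumr mulr_suml; apply: eq_bigr => i _.
  by rewrite ipZr iterE /exp_coeff/= mulrA (mulrC _^-1).
apply: cvg_lim => //.
have cK : expR K - series (exp_coeff K) n @[n --> \oo] --> (0 : R).
  rewrite -[X in _ --> X](subrr (expR K)); apply: cvgB; first exact: cvg_cst.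
  exact: is_cvg_series_exp_coeff.
apply/cvgrPdist_le => e e0.
have e1 : 0 < e / (`|x| + 1) by rewrite divr_gt0// ltr_wpDl.
move/cvgrPdist_le : cK => /(_ _ e1); apply: filterS => n.
rewrite sub0r normrN => hn.
(* The remainder at [K] dominates a norm, namely that of the remainder at 0. *)
have t0 : 0 <= expR K - series (exp_coeff K) n.
  apply: le_trans (expR_partial_sum_le n (_ : `|0| <= K)) => //.
  by rewrite normr0 (le_trans _ (dK 0%N)).
rewrite distrC.
apply: (@le_trans _ _ ((expR K - series (exp_coeff K) n) * `|x|)).
  apply: (norm_le_coord hip fB) => // k.
  rewrite ipBr serE (ip_diag hip fB eK) -mulrBl normrM ler_wpM2r//.
  exact: expR_partial_sum_le.
rewrite ger0_norm// in hn; rewrite (le_trans (ler_wpM2r _ hn))//.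
by rewrite mulrAC ler_pdivrMr ?ltr_wpDl// ler_wpM2l ?(ltW e0)// lerDl.
Qed.

Lemma op_pow_diag (P : H -> H) : positive_definite ip P ->
  (exists d, eigen_decomposition ip P d) ->
  exists (e : nat -> H) (l : nat -> R) (c K : R),
    [/\ 0 < c, orthonormal_basis ip e, forall k, P (e k) = l k *: e k,
       forall k, c <= l k <= K
     & forall s, op_pow ip P s = diag ip e (fun k => expR (s * ln (l k)))].
Proof.
move=> [[[linP contP] saP] [c c0 hc]] exd.
(* This is the very choice made inside [spectral_calculus]; by [exd] it is a genuine eigenbasis and
   not the default value. *)
set d := xget (fun=> 0, fun=> 0) [set d | eigen_decomposition ip P d].
have [eB Pe] : eigen_decomposition ip P d.
  by case: exd => d0 hd0; exact: (xgetI (fun=> 0, fun=> 0) hd0).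
have [K K0 hK] := (bounded_operatorP linP).1 contP.
have e1 k := onb_norm hip eB k.
have lcK k : c <= d.2 k <= K.
  apply/andP; split.
    by have := hc (d.1 k); rewrite Pe ipZr eB.1 e1 eqxx expr1n !mulr1.
  by have := hK (d.1 k); rewrite Pe normrZ e1 !mulr1; apply: le_trans (ler_norm _).
have l0 k : 0 < d.2 k by case/andP : (lcK k) => /(lt_le_trans c0).
exists d.1, d.2, c, K; split=> // s.
exact: (op_exp_diag s eB (fun k => ln_norm_le c0 (lcK k))).
Qed.

End Powers.

(** * Weak limits and Hilbert-Schmidt operators *)

Lemma cvg_sum (R : realType) (T : Type) (F : set_system T) {FF : Filter F}
    (m n : nat) (u : nat -> T -> R) (l : nat -> R) :
  (forall k, u k t @[t --> F] --> l k) ->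
  (\sum_(m <= k < n) u k t) @[t --> F] --> \sum_(m <= k < n) l k.
Proof. by move=> ul; apply: cvg_big => //; exact: add_continuous. Qed.

Lemma ultraFilter_fmap (T S : Type) (g : T -> S) (U : set_system T) :
  UltraFilter U -> UltraFilter (g @ U).
Proof.
move=> UU; have PU := @ultra_proper _ _ UU.
apply: Build_UltraFilter => G GG UG; rewrite eqEsubset; split=> // A GA.
case: (in_ultra_setVsetC (g @^-1` A) UU) => // UA.
have GAC : G (~` A) by apply: UG.
have : G (A `&` ~` A) by exact: filterI.
by rewrite setICr => /filter_not_empty.
Qed.

Section HilbertSchmidt.
Variables (R : realType) (H : completeNormedModType R) (ip : {dot H for idfun}).
Hypothesis hip : induces_norm ip.
Variable e : nat -> H.
Hypothesis eB : orthonormal_basis ip e.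
Implicit Types (x y : H) (z : nat -> H).

(** Expand [T (f k)] in the basis [e], exchange the two sums, move [T] across the inner product and
    apply Bessel's inequality for [f] to each [T (e j)]. *)
Lemma hilbert_schmidt_sum_le (T : H -> H) (f : nat -> H) (M : R) :
  adjoint_of ip T T -> (forall i j, ip (f i) (f j) = (i == j)%:R) ->
  (forall n, \sum_(0 <= k < n) `|T (e k)| ^+ 2 <= M) ->
  forall n, \sum_(0 <= k < n) `|T (f k)| ^+ 2 <= M.
Proof.
move=> saT fON hM n.
have h : (\sum_(0 <= k < n) series (fun j => ip (e j) (T (f k)) ^+ 2) m)
    @[m --> \oo] --> \sum_(0 <= k < n) `|T (f k)| ^+ 2.
  by apply: cvg_sum => k; exact: cvg_parseval_norm.
apply: (ler_cvg_to h (cvg_cst M)); apply: nearW => m.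
rewrite /series/= exchange_big/= (le_trans _ (hM m))//.
apply: ler_sum => j _; rewrite (le_trans _ (bessel hip fON (T (e j)) n))//.
apply: ler_sum => k _; rewrite -saT ipC//.
Qed.

Section WeakConvergence.
Variables (U : set_system nat) (z : nat -> H) (C : R).
Hypothesis UU : ProperFilter U.
Hypothesis zC : forall n, `|z n| <= C.

Let C0 : 0 <= C. Proof. exact: le_trans (zC 0%N). Qed.

Lemma weakly_null_basis : (forall k, ip (e k) (z n) @[n --> U] --> (0 : R)) ->
  forall y, ip y (z n) @[n --> U] --> (0 : R).
Proof.
move=> h y; apply/cvgrPdist_le => d d0.
have d2 : 0 < d / 2 by rewrite divr_gt0.
have dC : 0 < d / 2 / (C + 1) by rewrite divr_gt0// ltr_wpDl.
(* [y] is replaced by a finite expansion [s]; the error [ip (y - s) (z n)] is at most [|y - s| * C],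
   small uniformly in [n]. *)
have [N _ /(_ N (leqnn N))] := (cvgrPdist_le _ _).1 (eB.2 y) _ dC.
set s := series _ N => ys.
have hs : ip s (z n) @[n --> U] --> (0 : R).
  rewrite (_ : (fun n => _) =
      fun n => \sum_(0 <= k < N) ip (e k) y * ip (e k) (z n)).
    rewrite -[X in _ --> X](_ : \sum_(0 <= k < N) ip (e k) y * 0 = 0).
      by apply: cvg_sum => k; apply: cvgMr; exact: h.
    by rewrite big1// => k _; rewrite mulr0.
  apply/funext => n; rewrite /s/series/= ip_suml.
  by apply: eq_bigr => k _; rewrite ipZl.
move/cvgrPdist_le : hs => /(_ _ d2); apply: filterS => n.
rewrite !sub0r !normrN => hn.
rewrite -(subrK s y) ipDl (le_trans (ler_normD _ _))// (splitr d) lerD//.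
rewrite (le_trans (cauchy_schwarz hip _ _))//.
rewrite (le_trans (ler_pM _ _ ys (zC n)))//.
by rewrite mulrAC ler_pdivrMr ?ltr_wpDl// ler_wpM2l ?(ltW d2)// lerDl.
Qed.

(** In the Parseval sum of [T (z n)] the coordinates are [ip (T (e k)) (z n)]: finitely many tend to
    0, and the squares of the others add up to at most [C ^+ 2] times a tail of the Hilbert-Schmidt
    sum. *)
Lemma hilbert_schmidt_weakly_null (T : H -> H) (M : R) :
  adjoint_of ip T T -> (forall n, \sum_(0 <= k < n) `|T (e k)| ^+ 2 <= M) ->
  (forall y, ip y (z n) @[n --> U] --> (0 : R)) ->
  `|T (z n)| @[n --> U] --> (0 : R).
Proof.
move=> saT hM h; apply/cvgrPdist_le => d d0.
have d2 : 0 < d ^+ 2 / 2 by rewrite divr_gt0// exprn_gt0.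
have dC : 0 < d ^+ 2 / 2 / (C ^+ 2 + 1) by rewrite divr_gt0// ltr_wpDl// sqr_ge0.
have [N hN] := series_nneg_tail (fun k => sqr_ge0 `|T (e k)|) hM dC.
have hs : (\sum_(0 <= k < N) ip (T (e k)) (z n) ^+ 2) @[n --> U] --> (0 : R).
  rewrite -[X in _ --> X](_ : \sum_(0 <= k < N) (0 : R) ^+ 2 = 0).
    by apply: cvg_sum => k; rewrite expr2; apply: cvgM; exact: h.
  by rewrite big1// => k _; rewrite expr0n.
move/cvgrPdist_le : hs => /(_ _ d2); apply: filterS => n.
rewrite !sub0r !normrN normr_id ger0_norm ?sumr_ge0// => [hn|k _]; last exact: sqr_ge0.
rewrite -(@ler_pXn2r _ 2) ?nnegrE ?(ltW d0)//.
apply: (ler_cvg_to (cvg_parseval_norm hip eB (T (z n))) (cvg_cst _)).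
exists N => // m /= Nm; rewrite /series/= (@big_cat_nat _ _ _ N)//=.
rewrite (splitr (d ^+ 2)) lerD//.
  by under eq_bigr do rewrite -saT.
rewrite (@le_trans _ _ (\sum_(N <= k < m) `|T (e k)| ^+ 2 * C ^+ 2))//.
  apply: ler_sum => k _; rewrite -saT -[leLHS]real_normK ?num_real// -exprMn.
  rewrite ler_pXn2r ?nnegrE ?mulr_ge0// (le_trans (cauchy_schwarz hip _ _))//.
  by rewrite ler_wpM2l.
rewrite -mulr_suml (le_trans (ler_wpM2r (sqr_ge0 _) (hN N m (leqnn N))))//.
rewrite mulrAC ler_pdivrMr ?ltr_wpDl ?sqr_ge0// ler_wpM2l ?(ltW d2)//.
by rewrite lerDl.
Qed.

End WeakConvergence.

(** Every coordinate stays in the compact segment [[-1, 1]], so one ultrafilter makes all of them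
    converge at once, without diagonal extraction. Bessel's inequality passes to the limits, and
    Riesz-Fischer assembles them into a vector. *)
Lemma bounded_seq_weak_limit (z : nat -> H) : (forall n, `|z n| <= 1) ->
  exists (U : set_system nat) (x : H), [/\ UltraFilter U, \oo `<=` U, `|x| <= 1
    & forall y, ip y (z n) @[n --> U] --> ip y x].
Proof.
move=> z1.
have [U [UU oU]] := ultraFilterLemma (@eventually_filter : ProperFilter \oo).
have PU := @ultra_proper _ _ UU.
have lim_ex k : exists c : R, ip (e k) (z n) @[n --> U] --> c.
  have cpt := @segment_compact R (-1) 1; rewrite compact_ultra in cpt.
  have /cpt[|c [_ hc]] := ultraFilter_fmap (fun n => ip (e k) (z n)) UU.
    apply: (@filterS _ U _ setT); last exact: filterT.
    move=> n _ /=; rewrite in_itv/= -ler_norml.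
    rewrite (le_trans (cauchy_schwarz hip _ _))//.
    by rewrite (onb_norm hip eB) mul1r.
  by exists c.
have [c hc] := choice lim_ex.
have c1 n : \sum_(0 <= k < n) c k ^+ 2 <= 1.
  have h : (\sum_(0 <= k < n) ip (e k) (z m) ^+ 2) @[m --> U] -->
      \sum_(0 <= k < n) c k ^+ 2.
    by apply: cvg_sum => k; rewrite expr2; apply: cvgM; exact: hc.
  apply: (ler_cvg_to h (cvg_cst (1 : R))); apply: filterS filterT => m _.
  by rewrite (le_trans (bessel hip eB.1 _ _))// exprn_ile1.
set x := limn (series (fun k => c k *: e k)).
have ex k : ip (e k) x = c k.
  by rewrite (ip_lim_series hip eB.1)//; exact: (riesz_fischer hip eB.1 c1).
have x1 : `|x| <= 1.
  rewrite -(@ler_pXn2r _ 2) ?nnegrE// expr1n.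
  apply: (ler_cvg_to (cvg_parseval_norm hip eB x) (cvg_cst (1 : R))).
  by apply: nearW => n; rewrite /series/=; under eq_bigr do rewrite ex.
exists U, x; split=> // y.
have zx n : `|z n - x| <= 2.
  by rewrite (le_trans (ler_normB _ _))// (_ : 2 = 1 + 1)// lerD.
have h : ip y (z n - x) @[n --> U] --> (0 : R).
  apply: (weakly_null_basis PU zx) => k.
  rewrite (_ : (fun n => _) = fun n => ip (e k) (z n) - c k).
    by rewrite -[X in _ --> X](subrr (c k)); apply: cvgB => //; exact: cvg_cst.
  by apply/funext => n; rewrite ipBr ex.
rewrite -[X in _ --> X]add0r.
rewrite (_ : (fun n => _) = fun n => ip y (z n - x) + ip y x).
  by apply: cvgD => //; exact: cvg_cst.
by apply/funext => n; rewrite ipBr subrK.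
Qed.

End HilbertSchmidt.

(** * Spectral theorem *)

Section SpectralTheorem.
Variables (R : realType) (H : completeNormedModType R) (ip : {dot H for idfun}).
Hypothesis hip : induces_norm ip.
Hypothesis hdim : infinite_dimensional H.
Variables (e : nat -> H) (T : H -> H) (M : R).
Hypothesis eB : orthonormal_basis ip e.
Hypothesis saT : self_adjoint ip T.
Hypothesis hM : forall n, \sum_(0 <= k < n) `|T (e k)| ^+ 2 <= M.
Implicit Types (x y v w : H) (V : set H).

Let linT := saT.1.1.
Let TZ := let: And4 _ _ h _ := linear_opP linT in h.
Let TD := let: And4 h _ _ _ := linear_opP linT in h.
Let TB := let: And4 _ h _ _ := linear_opP linT in h.

Let eigenvector v := exists l : R, T v = l *: v.

Lemma exists_eigenvector_orthogonal V : (forall v, V v -> eigenvector v) ->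
  (exists2 w, w != 0 & forall v, V v -> ip v w = 0) ->
  exists x, [/\ `|x| = 1, forall v, V v -> ip v x = 0 & eigenvector x].
Proof.
move=> Veig [w w0 Vw].
pose W := [set x | forall v, V v -> ip v x = 0].
have WZ a x : W x -> W (a *: x) by move=> Wx v Vv; rewrite ipZr Wx// mulr0.
have WD x y : W x -> W y -> W (x + y).
  by move=> Wx Wy v Vv; rewrite ipDr Wx// Wy// addr0.
(* The complement [W] is invariant because [V] consists of eigenvectors of the self-adjoint [T]. *)
have WT x : W x -> W (T x).
  move=> Wx v Vv; have [l Tv] := Veig v Vv.
  by rewrite -saT.2 Tv ipZl Wx// mulr0.
have Wunit x : x != 0 -> W x -> W (`|x|^-1 *: x) /\ `| `|x|^-1 *: x| = 1.
  move=> x0 Wx; split; first exact: WZ.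
  by rewrite normrZ normfV normr_id mulVf// normr_eq0.
have [K K0 hK] := (bounded_operatorP linT).1 saT.1.2.
pose S := [set `|T x| | x in [set x | W x /\ `|x| = 1]].
have supS : has_sup S.
  split; last by exists K => _ [x [_ x1] <-]; rewrite (le_trans (hK x))// x1 mulr1.
  by have [Ww w1] := Wunit w w0 Vw; exists `|T (`|w|^-1 *: w)|; exists (`|w|^-1 *: w).
set m := sup S.
have Tm x : W x -> `|T x| <= m * `|x|.
  move=> Wx; have [->|x0] := eqVneq x 0.
    by rewrite -(scale0r 0) TZ !scale0r normr0 mulr0.
  have := sup_upper_bound supS; rewrite -/m => /(_ `|T (`|x|^-1 *: x)|).
  have [Wx1 nx1] := Wunit x x0 Wx.
  rewrite TZ normrZ normfV normr_id => h.
  rewrite -ler_pdivrMr ?normr_gt0// mulrC; apply: h.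
  by exists (`|x|^-1 *: x) => //; rewrite TZ normrZ normfV normr_id.
have m0 : 0 <= m.
  have [Ww w1] := Wunit w w0 Vw.
  by have := Tm _ Ww; rewrite w1 mulr1; apply: le_trans.
have [m_eq0|m_neq0] := eqVneq m 0.
  have [Ww w1] := Wunit w w0 Vw; exists (`|w|^-1 *: w); split=> //.
  exists 0; rewrite scale0r; apply/eqP; rewrite -normr_le0.
  by rewrite (le_trans (Tm _ Ww))// m_eq0 mul0r.
have m_gt0 : 0 < m by rewrite lt_def m_neq0.
have seq_ex n : exists x, [/\ W x, `|x| = 1 & m - n.+1%:R^-1 < `|T x|].
  have n0 : (0 : R) < n.+1%:R^-1 by rewrite invr_gt0.
  by have [_ [x [Wx x1] <-] hx] := sup_adherent n0 supS; exists x.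
have [z hz] := choice seq_ex.
have z1 n : `|z n| <= 1 by have [_ -> _] := hz n.
have [U [x [UU oU x1 zx]]] := bounded_seq_weak_limit hip eB z1.
have PU := @ultra_proper _ _ UU.
have Wx : W x.
  move=> v Vv; rewrite -(cvg_lim (@Rhausdorff R) (zx v)).
  rewrite (_ : (fun n => _) = fun=> 0); first exact: (lim_cst (@Rhausdorff R)).
  by apply/funext => n; have [Wz _ _] := hz n; exact: Wz.
have zx2 n : `|z n - x| <= 2.
  by rewrite (le_trans (ler_normB _ _))// (_ : 2 = 1 + 1)// lerD.
have Tzx : `|T (z n - x)| @[n --> U] --> (0 : R).
  apply: (hilbert_schmidt_weakly_null hip eB PU zx2 saT.2 hM) => y.
  rewrite (_ : (fun n => _) = fun n => ip y (z n) - ip y x).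
    rewrite -[X in _ --> X](subrr (ip y x)).
    by apply: cvgB => //; exact: cvg_cst.
  by apply/funext => n; rewrite ipBr.
have Tx : `|T x| = m.
  apply/eqP; rewrite eq_le; apply/andP; split.
    by rewrite (le_trans (Tm x Wx))// ler_piMr.
  have h1 : (m - n.+1%:R^-1) - `|T (z n - x)| @[n --> U] --> m - 0 - 0.
    apply: cvgB => //; apply: cvgB; first exact: cvg_cst.
    by apply: cvg_trans (@cvg_harmonic R) => P; exact: oU.
  rewrite !subr0 in h1.
  apply: (ler_cvg_to h1 (cvg_cst (`|T x| : R))); apply: nearW => n.
  have [_ _ /ltW hn] := hz n; rewrite lerBlDr (le_trans hn)//.
  by rewrite TB -lerBlDl (le_trans (lerB_dist _ _)).
(* A weak limit may lose norm; here [m = |T x| <= m * |x|] with [m > 0] prevents it. *)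
have nx1 : `|x| = 1.
  by apply/eqP; rewrite eq_le x1/= -(ler_pM2l m_gt0) mulr1 -[leLHS]Tx Tm.
(* The squared norm of the difference is [|T (T x)|^2 - 2 m^4 + m^4], and
   [|T (T x)| <= m |T x| = m^2]. *)
have TTx : T (T x) = m ^+ 2 *: x.
  apply/eqP; rewrite -subr_eq0 -normr_le0 -(@ler_pXn2r _ 2) ?nnegrE//.
  have xTTx : ip x (T (T x)) = m ^+ 2 by rewrite -saT.2 -hip Tx.
  rewrite hip ipBl !ipBr !ipZl !ipZr (ipC _ _ x) xTTx -!hip nx1.
  have : `|T (T x)| ^+ 2 <= (m ^+ 2) ^+ 2.
    by rewrite ler_pXn2r ?nnegrE ?sqr_ge0// (le_trans (Tm _ (WT _ Wx)))// Tx.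
  by rewrite expr0n /=; lra.
(* Since [(T - m) (T + m) x = 0], either [x] is an eigenvector for [- m], or [T x + m *: x] is a
   nonzero one for [m]. *)
have [y0|y0] := eqVneq (T x + m *: x) 0.
  exists x; split=> //; exists (- m).
  by rewrite scaleNr; apply/eqP; rewrite -addr_eq0 y0.
have Wy : W (T x + m *: x) by apply: WD; [exact: WT|exact: WZ].
have [Wy1 ny1] := Wunit _ y0 Wy.
eexists; split; [exact: ny1|exact: Wy1|exists m].
rewrite TZ TD TZ TTx [RHS]scalerA [m * _]mulrC -[RHS]scalerA; congr (_ *: _).
by rewrite scalerDr addrC scalerA expr2.
Qed.

(** Otherwise each [x] would equal its projection on the [n] vectors, which would then span the
    space. *)
Lemma orthonormal_complement_neq0 (v : nat -> H) n :
  (forall i j, (i < n)%N -> (j < n)%N -> ip (v i) (v j) = (i == j)%:R) ->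
  exists2 w, w != 0 & forall i, (i < n)%N -> ip (v i) w = 0.
Proof.
move=> vON; apply: contrapT => h; apply: hdim.
exists n, (fun i => v i) => x; exists (fun i => ip (v i) x).
apply/eqP; rewrite -subr_eq0; apply/negP => /negP w0; apply: h.
eexists; first exact: w0.
move=> i ni; rewrite ipBr ip_sumr (bigD1 (Ordinal ni))//=.
rewrite ipZr vON// eqxx mulr1 big1 ?addr0 ?subrr// => j ji.
by rewrite ipZr vON// eq_sym (_ : (j == i :> nat) = false) ?mulr0//; apply/negbTE.
Qed.

(* [good j v] holds for all large [j]. An orthonormal sequence cannot consist
   of vectors that are [good] for one fixed [j], so choosing each new
   eigenvector with the least possible [j] exhausts the space. *)
Let good j v := exists2 i, (i <= j)%N & j.+1%:R^-1 < ip (e i) v ^+ 2.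

Let exists_good v : `|v| = 1 -> exists j, good j v.
Proof.
move=> v1.
have [i vi] : exists i, ip (e i) v != 0.
  apply: contrapT => h; have v0 : v = 0.
    apply: (onb_ext eB) => i; rewrite ip0r; apply/eqP/negPn/negP => vi.
    by apply: h; exists i.
  by move/eqP : v1; rewrite v0 normr0 eq_sym oner_eq0.
have v2 : 0 < ip (e i) v ^+ 2 by rewrite lt_def sqr_ge0 sqrf_eq0 vi.
pose N := Num.truncn (ip (e i) v ^+ 2)^-1.
(* The level must reach the index [i] of a nonzero coordinate and make the threshold smaller than
   its square. *)
exists (maxn i N), i; first exact: leq_maxl.
rewrite invf_plt ?posrE//.
rewrite (lt_le_trans (truncnS_gt _))// ler_nat ltnS leq_maxr//.
Qed.

Let good_monotone j k v : (j <= k)%N -> good j v -> good k v.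
Proof.
move=> jk [i ij h]; exists i; first exact: leq_trans jk.
by rewrite (le_lt_trans _ h)// lef_pV2 ?posrE// ler_nat.
Qed.

(** Double counting of the squares [ip (e i) (v n) ^+ 2] for [i <= j]: each [v n] contributes at
    least [1 / (j + 1)], while Bessel's inequality allows at most 1 for each [e i]. With
    [(j + 1)^2 + 1] vectors this is impossible. *)
Let not_all_good (v : nat -> H) j :
  (forall i k, ip (v i) (v k) = (i == k)%:R) -> ~ forall n, good j (v n).
Proof.
move=> vON vj.
have j0 : 0 < j.+1%:R :> R by [].
pose N := (j.+1 * j.+1).+1.
have h1 : N%:R / j.+1%:R <=
    \sum_(0 <= n < N) \sum_(0 <= i < j.+1) ip (e i) (v n) ^+ 2.
  rewrite -[N in leLHS]subn0 mulr_natl -sumr_const_nat; apply: ler_sum => n _.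
  have [i ij /ltW h] := vj n; rewrite (le_trans h)//.
  rewrite (bigD1_seq i) ?mem_index_iota ?iota_uniq//=.
  by rewrite lerDl sumr_ge0// => k _; exact: sqr_ge0.
have h2 : \sum_(0 <= n < N) \sum_(0 <= i < j.+1) ip (e i) (v n) ^+ 2
    <= j.+1%:R.
  rewrite exchange_big/= -[j.+1 in leRHS]subn0 -sumr_const_nat.
  apply: ler_sum => k _; under eq_bigr => n _ do rewrite ipC.
  by rewrite (le_trans (bessel hip vON _ _))// hip eB.1 eqxx.
have := le_trans h1 h2; rewrite ler_pdivrMr// -natrM ler_nat.
by rewrite ltnn.
Qed.

Lemma spectral_theorem : exists d, eigen_decomposition ip T d.
Proof.
pose spec (s : seq H) v :=
  [/\ `|v| = 1, forall u, u \in s -> ip u v = 0 & eigenvector v].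
pose orthonormal_eigen (s : seq H) :=
  (forall i j, (i < size s)%N -> (j < size s)%N ->
    ip (nth 0 s i) (nth 0 s j) = (i == j)%:R) /\
  (forall u, u \in s -> eigenvector u).
(* The assumption on [s] stands under the existential so that [choice] gives a function on all
   lists; a list that violates it gets 0. *)
have step s : exists v, orthonormal_eigen s -> spec s v /\
    forall w j, spec s w -> good j w -> good j v.
  have [[sON seig]|?] := pselect (orthonormal_eigen s); last by exists 0.
  have [w w0 sw] := orthonormal_complement_neq0 sON.
  have [w1 spw1] : exists w1, spec s w1.
    apply: (exists_eigenvector_orthogonal (V := [set u | u \in s]) seig).
    by exists w => // v /= /(nthP 0)[i si <-]; exact: sw.
  have [j0 gw1] : exists j, good j w1 by apply: exists_good; have [] := spw1.
  have [j /asboolP[v [spv gv]] jmin] := @ex_minnP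
    (fun j => `[< exists v, spec s v /\ good j v >])
    (ex_intro _ j0 (asboolT (ex_intro _ w1 (conj spw1 gw1)))).
  exists v => _; split=> // u k spu gu.
  by apply: good_monotone gv; apply: jmin; apply/asboolP; exists u.
have [g hg] := choice step.
pose v n := g (iter n (fun s => rcons s (g s)) [::]).
have ssE n : iter n (fun s => rcons s (g s)) [::] = mkseq v n.
  by elim: n => // n IH; rewrite iterS mkseqS -IH.
(* Only earlier indices are assumed, so that this serves as the step of the strong induction for
   [spv]. *)
have oe n : (forall i, (i < n)%N -> spec (mkseq v i) (v i)) ->
    orthonormal_eigen (mkseq v n).
  move=> IH; split; last first.
    by move=> u /mapP[i]; rewrite mem_iota => /IH[_ _ ?] ->.
  rewrite size_mkseq => i j ni nj; rewrite !nth_mkseq//.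
  have lt_orth k l : (l < n)%N -> (k < l)%N -> ip (v k) (v l) = 0.
    move=> ln kl; have [_ + _] := IH l ln; apply.
    by apply/mapP; exists k; rewrite ?mem_iota.
  case: ltngtP => ij; [exact: lt_orth|by rewrite ipC lt_orth|].
  by rewrite ij -hip; have [-> _ _] := IH j nj; rewrite expr1n.
have spv n : spec (mkseq v n) (v n).
  elim/ltn_ind: n => n IH; rewrite /v ssE.
  by have [] := hg _ (oe n IH).
have good_v n w j : spec (mkseq v n) w -> good j w -> good j (v n).
  rewrite /v ssE; have [_] := hg _ (oe n (fun i _ => spv i)); exact.
have vON i j : ip (v i) (v j) = (i == j)%:R.
  have [h _] := oe (maxn i j).+1 (fun i _ => spv i).
  have := h i j; rewrite size_mkseq !ltnS leq_maxl leq_maxr.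
  by rewrite !nth_mkseq ?ltnS ?leq_maxl ?leq_maxr//; apply.
have veig n : eigenvector (v n) by have [] := spv n.
(* A unit eigenvector [w] orthogonal to all [v n] would be a candidate at every stage, so each [v n]
   would be [good] at the level of [w]. *)
have vmax x : (forall k, ip (v k) x = 0) -> x = 0.
  move=> vx; apply/eqP/negPn/negP => x0.
  have [w [w1 vw weig]] : exists w,
      [/\ `|w| = 1, forall u, range v u -> ip u w = 0 & eigenvector w].
    apply: exists_eigenvector_orthogonal => [_ [n _ <-]//|].
    by exists x => // _ [n _ <-].
  have [j gw] := exists_good w1.
  apply: (not_all_good vON (j := j)) => n.
  apply: good_v gw; split=> // _ /mapP[i _ ->].
  by apply: vw; exists i.
have [l hl] := choice veig.
exists (v, l); split=> //=; split=> // x.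
have cx : cvgn (series (fun k => ip (v k) x *: v k)).
  exact: (riesz_fischer hip vON (bessel hip vON x)).
have limx : limn (series (fun k => ip (v k) x *: v k)) = x.
  apply/esym/eqP; rewrite -subr_eq0; apply/eqP/vmax => k.
  by rewrite ipBr (ip_lim_series hip vON)// subrr.
by move: cx; rewrite /cvg_to limx.
Qed.

End SpectralTheorem.

(** * Scalar estimates *)

Section ScalarEstimates.
Variable R : realType.
Implicit Types (t u c K : R).

(** From [1 + u <= expR u] at [u] and [- u] follow [0 <= expR u - 1 - u <= u * (expR u - 1)]; the
    last product is at most [u^2 * expR u] for [u >= 0] and at most [u^2] for [u < 0]. *)
Lemma expR_taylor1_le u (U : R) : `|u| <= U ->
  `|expR u - 1 - u| <= u ^+ 2 * expR U.
Proof.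
move=> uU.
have h0 := expR_ge1Dx u.
have h1 : expR u - 1 <= u * expR u.
  have := expR_ge1Dx (- u); rewrite expRN => h.
  have e0 := expR_gt0 u.
  have : (1 - u) * expR u <= 1 by rewrite -ler_pdivlMr// mul1r.
  by rewrite mulrBl mul1r; lra.
have U1 : 1 <= expR U.
  by rewrite -expR0 ler_expR (le_trans _ uU).
have uU1 : expR u <= expR U by rewrite ler_expR (le_trans (ler_norm _)).
have u2 := sqr_ge0 u.
rewrite ger0_norm; last by lra.
have [u0|u0] := leP 0 u.
  apply: (@le_trans _ _ (u * (u * expR u))); last by rewrite mulrA -expr2 ler_wpM2l.
  apply: (@le_trans _ _ (u * (expR u - 1))); last by rewrite ler_wpM2l.
  by rewrite mulrBr mulr1; lra.
apply: (@le_trans _ _ (u ^+ 2)); last by rewrite ler_peMr.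
apply: (@le_trans _ _ (u * (expR u - 1))); first by rewrite mulrBr mulr1; lra.
by rewrite expr2 ler_wnM2l ?(ltW u0)//; lra.
Qed.

Lemma ln_lipschitz c t u : 0 < c -> c <= t -> c <= u ->
  `|ln t - ln u| <= `|t - u| / c.
Proof.
move=> c0.
have half (x y : R) : c <= x -> c <= y -> ln x - ln y <= `|x - y| / c.
  move=> cx cy; have x0 := lt_le_trans c0 cx; have y0 := lt_le_trans c0 cy.
  rewrite -ln_div ?posrE//; apply: (@le_trans _ _ ((x - y) / y)).
    rewrite -[x / y](subrK 1) addrC mulrBl divff ?gt_eqF//.
    by apply: le_ln1Dx; rewrite ltrBrDr addNr divr_gt0.
  apply: (@le_trans _ _ (`|x - y| / y)).
    by rewrite ler_wpM2r ?invr_ge0 ?(ltW y0)// ler_norm.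
  by rewrite ler_wpM2l// lef_pV2 ?posrE.
move=> ct cu; rewrite ler_norml half// andbT lerNl opprB distrC.
exact: half.
Qed.

(* The hypothesis says that the derivative of
   [t |-> alpha t^p + beta t^(-q)] vanishes at [nu]. *)
Lemma power_mean_quadratic (alpha beta p q nu c K : R) :
  0 < alpha -> 0 < beta -> 0 < nu -> 0 < c ->
  p * alpha * expR (p * ln nu) = q * beta * expR (- q * ln nu) ->
  let F t := (alpha + beta)^-1 *
    (alpha * expR (p * ln t) + beta * expR (- q * ln t)) in
  exists2 C, 0 <= C &
    forall t, c <= t <= K -> `|F t - F nu| <= C * (t - nu) ^+ 2.
Proof.
move=> a0 b0 nu0 c0 hpq F.
(* Both [t] and [nu] are at least [c'], so [1 / c'] is a Lipschitz constant of [ln] between them,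
   and [L] bounds [|ln t - ln nu|]. *)
pose c' := Num.min c nu.
have c'0 : 0 < c' by rewrite lt_min c0.
pose L := (`|K| + nu) / c'.
have ab0 : 0 < alpha + beta by exact: addr_gt0.
pose E s := expR (s * ln nu).
have E0 s : 0 < E s by exact: expR_gt0.
pose B := (alpha + beta)^-1 * (alpha * E p * (p ^+ 2 * expR (`|p| * L)) +
   beta * E (- q) * (q ^+ 2 * expR (`|q| * L))).
have B0 : 0 <= B.
  apply: mulr_ge0; first by rewrite invr_ge0 ltW.
  have nneg (x y r w : R) : 0 < x -> 0 < y -> 0 <= x * y * (r ^+ 2 * expR w).
    move=> x0 y0; apply: mulr_ge0; apply: mulr_ge0; rewrite ?sqr_ge0 ?expR_ge0 ?(ltW x0) ?(ltW y0)//.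
  by apply: addr_ge0; exact: nneg.
exists (B / c' ^+ 2); first by rewrite divr_ge0// sqr_ge0.
move=> t /andP[ct tK].
have t0 := lt_le_trans c0 ct.
set d := ln t - ln nu.
have dl : `|d| <= `|t - nu| / c'.
  by apply: ln_lipschitz => //; rewrite ge_min ?ct ?lexx ?orbT.
have dL : `|d| <= L.
  rewrite (le_trans dl)// ler_wpM2r ?invr_ge0 ?(ltW c'0)//.
  rewrite (le_trans (ler_normB _ _))// (gtr0_norm nu0) lerD2r gtr0_norm//.
  by rewrite (le_trans tK)// ler_norm.
have Et s : expR (s * ln t) = E s * expR (s * d).
  by rewrite /E -expRD /d mulrBr addrC subrK.
have hr s : `|expR (s * d) - 1 - s * d| <= s ^+ 2 * expR (`|s| * L) * d ^+ 2.
  apply: le_trans (expR_taylor1_le (_ : _ <= `|s| * L)) _.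
    by rewrite normrM ler_wpM2l.
  by rewrite exprMn mulrAC.
(* The first-order terms inserted here have sum zero, by the relation between [p] and [q]; only
   second-order remainders are left. *)
have -> : F t - F nu = (alpha + beta)^-1 *
    (alpha * E p * (expR (p * d) - 1 - p * d) +
     beta * E (- q) * (expR (- q * d) - 1 - (- q) * d)).
  rewrite /F !Et -/(E p) -/(E (- q)) -mulrBr; congr (_ * _).
  have : p * alpha * E p = q * beta * E (- q) by [].
  by move=> h; ring: h.
rewrite normrM gtr0_norm ?invr_gt0//.
apply: (@le_trans _ _ (B * d ^+ 2)).
  rewrite /B -[leRHS]mulrA ler_wpM2l ?invr_ge0 ?(ltW ab0)//.
  rewrite (le_trans (ler_normD _ _))// mulrDl lerD//.
    rewrite normrM gtr0_norm ?mulr_gt0// -[leRHS]mulrA ler_wpM2l//.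
    by rewrite mulr_ge0// ltW.
  rewrite normrM gtr0_norm ?mulr_gt0// -[leRHS]mulrA ler_wpM2l//.
    by rewrite mulr_ge0// ltW.
  by rewrite (le_trans (hr _))// sqrrN normrN.
rewrite -[leRHS]mulrA ler_wpM2l// [leRHS]mulrC -expr_div_n -[d ^+ 2]real_normK ?num_real//.
rewrite -[leRHS]real_normK ?num_real// ler_pXn2r ?nnegrE//.
by rewrite normrM normfV (gtr0_norm c'0).
Qed.

End ScalarEstimates.

(** * Powers of scalar perturbations of Hilbert-Schmidt operators *)

Section HilbertSchmidtPowers.
Variables (R : realType) (H : completeNormedModType R) (ip : {dot H for idfun}).
Hypothesis hip : induces_norm ip.
Hypothesis hdim : infinite_dimensional H.
Implicit Types (A P S T : H -> H) (e f : nat -> H) (g s M : R).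

Lemma hilbert_schmidt_bound T : hilbert_schmidt ip T ->
  exists e M, orthonormal_basis ip e /\
    forall n, \sum_(0 <= k < n) `|T (e k)| ^+ 2 <= M.
Proof.
move=> [_ [e eB cT]]; exists e.
have [M hM] := cvgn_series_nneg_le (fun k => sqr_ge0 `|T (e k)|) cT.
by exists M.
Qed.

Lemma hilbert_schmidt_bound_in T f : hilbert_schmidt ip T -> self_adjoint ip T ->
  orthonormal_basis ip f -> exists M, forall n, \sum_(0 <= k < n) `|T (f k)| ^+ 2 <= M.
Proof.
move=> /hilbert_schmidt_bound[e [M [eB hM]]] saT fB; exists M.
exact: (hilbert_schmidt_sum_le hip eB saT.2 fB.1).
Qed.

(** If [g <= 0], then [M <= ip (e k) (A (e k)) <= |A (e k)|] for all [k], although [A (e k)] tends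
    to 0. *)
Lemma scalar_part_gt0 A g : hilbert_schmidt ip A ->
  positive_definite ip (add_scalar A g) -> 0 < g.
Proof.
move=> [_ [e eB cT]] [_ [M M0 hM]]; rewrite ltNge; apply/negP => g0.
have h : M ^+ 2 <= 0.
  apply: (ler_cvg_to (cvg_cst (M ^+ 2 : R)) (cvg_series_cvg_0 cT)).
  apply: nearW => k; rewrite ler_pXn2r ?nnegrE ?(ltW M0)//.
  have := hM (e k); rewrite (onb_norm hip eB) expr1n mulr1 /add_scalar => h.
  rewrite (le_trans h)// ipDr ipZr eB.1 eqxx mulr1.
  rewrite (@le_trans _ _ (ip (e k) (A (e k))))//; first by rewrite gerDl.
  rewrite (le_trans (ler_norm _))// (le_trans (cauchy_schwarz hip _ _))//.
  by rewrite (onb_norm hip eB) mul1r.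
by move: h; rewrite leNgt exprn_gt0.
Qed.

Lemma bounded_operator_comp S T :
  bounded_operator S -> bounded_operator T -> bounded_operator (S \o T).
Proof.
move=> [linS cS] [linT cT]; split; last first.
  by move=> x; apply: continuous_comp; [exact: cT|exact: cS].
by move=> a x y /=; rewrite linT linS.
Qed.

Lemma self_adjoint_add_scalar A g :
  self_adjoint ip A -> self_adjoint ip (add_scalar A g).
Proof.
move=> [[linA cA] sA]; split; last first.
  by move=> x y; rewrite /add_scalar ipDl ipDr ipZl ipZr sA.
split.
  move=> a x y; rewrite /add_scalar linA scalerDr !scalerA mulrC -scalerA.
  by rewrite scalerDr addrACA scalerA.
by move=> x; apply: cvgD; [exact: cA|apply: cvgZr; exact: cvg_id].
Qed.

(** The spectral theorem only ensures that an eigenbasis exists; [e] is the one picked by the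
    spectral calculus, and the Hilbert-Schmidt bound is carried over to it. *)
Lemma op_pow_hilbert_schmidt A g : hilbert_schmidt ip A -> self_adjoint ip A ->
  positive_definite ip (add_scalar A g) ->
  exists e (l : nat -> R) (c K L M : R),
    [/\ 0 < c, orthonormal_basis ip e, forall k, A (e k) = (l k - g) *: e k
       & forall k, c <= l k <= K] /\
    [/\ forall n, \sum_(0 <= k < n) (l k - g) ^+ 2 <= M,
       forall k, `|ln (l k)| <= L
     & forall s, op_pow ip (add_scalar A g) s =
         diag ip e (fun k => expR (s * ln (l k)))].
Proof.
move=> hsA saA pd.
have [e0 [M0 [e0B hM0]]] := hilbert_schmidt_bound hsA.
have [d [dB Ad]] := spectral_theorem hip hdim e0B saA hM0.
have [|e [l [c [K [c0 eB Pe lcK powE]]]]] := op_pow_diag hip pd.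
  exists (d.1, fun k => d.2 k + g); split=> //= k.
  by rewrite /add_scalar Ad scalerDl.
have Ae k : A (e k) = (l k - g) *: e k.
  by have := Pe k; rewrite /add_scalar scalerBl => <-; rewrite addrK.
have [M hM] := hilbert_schmidt_bound_in hsA saA eB.
exists e, l, c, K, (Num.max `|ln c| `|ln K|), M; split=> //; split=> // [n|k].
  rewrite (le_trans _ (hM n))//; apply: ler_sum => k _.
  by rewrite Ae normrZ (onb_norm hip eB) mulr1 real_normK ?num_real.
exact: ln_norm_le.
Qed.

(** The absolute value is diagonal with entries [|d k|], and its trace is computed in [e] itself. *)
Lemma trace_class_diag e (d : nat -> R) M : orthonormal_basis ip e ->
  (forall n, \sum_(0 <= k < n) `|d k| <= M) -> trace_class ip (diag ip e d).
Proof.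
move=> eB hM.
have dM k : `|d k| <= M.
  rewrite (le_trans _ (hM k.+1))// big_nat_recr//= lerDr.
  by rewrite sumr_ge0.
have dM' k : `| `|d k| | <= M by rewrite normr_id.
split; first exact: (diag_bounded_operator hip eB dM).
exists (diag ip e (fun k => `|d k|)); split; last first.
  exists e => //; apply: (cvgn_series_nneg (M := M)) => [k|n].
    by rewrite (diag_basis hip eB dM') ipZr eB.1 eqxx mulr1.
  rewrite (le_trans _ (hM n))//; apply: ler_sum => k _.
  by rewrite (diag_basis hip eB dM') ipZr eB.1 eqxx mulr1.
split; first split; first exact: (diag_self_adjoint hip eB dM').
  move=> x; have := diag_ge hip eB dM' (m := 0) x (fun k => normr_ge0 (d k)).
  by rewrite mul0r.
exists (diag ip e d); first exact: (diag_self_adjoint hip eB dM).2.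
move=> x; apply: (onb_ext eB) => k.
rewrite !(ip_diag hip eB dM) !(ip_diag hip eB dM') !mulrA -!expr2.
by rewrite real_normK ?num_real.
Qed.

End HilbertSchmidtPowers.

(** * The weighted mean of two powers of [add_scalar Lambda (gamma / mu)] *)

Theorem proposition2 (R : realType) (H : completeNormedModType R)
    (ip : {dot H for idfun}) (hip : induces_norm ip)
    (hsep : separable_space H) (hdim : infinite_dimensional H)
    (A B : H -> H) (gamma mu : R)
    (hA : hilbert_schmidt ip A) (hAs : self_adjoint ip A)
    (hB : hilbert_schmidt ip B) (hBs : self_adjoint ip B)
    (hAg : PC2 ip (add_scalar A gamma)) (hBm : PC2 ip (add_scalar B mu))
    (alpha beta : R) (halpha : 0 < alpha) (hbeta : 0 < beta) (p q : R)
    (hpq : p * alpha * (gamma / mu) `^ p = q * beta * (gamma / mu) `^ (- q))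
    (Lambda : H -> H)
    (hLambda : add_scalar Lambda (gamma / mu) =
       op_pow ip (add_scalar B mu) (- 2^-1) \o add_scalar A gamma
         \o op_pow ip (add_scalar B mu) (- 2^-1)) :
  PC1 ip (fun x : H => (alpha + beta)^-1 *:
    (alpha *: op_pow ip (add_scalar Lambda (gamma / mu)) p x
     + beta *: op_pow ip (add_scalar Lambda (gamma / mu)) (- q) x)).
Proof.
have pdA : positive_definite ip (add_scalar A gamma) by case: hAg => ? [? []].
have pdB : positive_definite ip (add_scalar B mu) by case: hBm => ? [? []].
have gamma0 := scalar_part_gt0 hip hA pdA.
have mu0 := scalar_part_gt0 hip hB pdB.
set nu := gamma / mu in hpq hLambda *.
have nu0 : 0 < nu by rewrite divr_gt0.
have [f [b [c [K [L [M [[c0 fB Bf bcK] [hM lnL powB]]]]]]]] :=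
  op_pow_hilbert_schmidt hip hdim hB hBs pdB.
set S := op_pow ip (add_scalar B mu) (- 2^-1) in hLambda.
pose s k := expR (- 2^-1 * ln (b k)).
have SE : S = diag ip f s by rewrite /S powB.
pose L' := 2^-1 * L.
have lnL' k : `|- 2^-1 * ln (b k)| <= L'.
  by rewrite normrM normrN [`|2^-1|]gtr0_norm ?invr_gt0// ler_wpM2l.
have sL k : `|s k| <= expR L'.
  by rewrite ger0_norm ?expR_ge0// ler_expR (le_trans (ler_norm _)).
have sm k : expR (- L') <= s k.
  by rewrite ler_expR; have := lnL' k; rewrite ler_norml => /andP[].
have saS : self_adjoint ip S by rewrite SE; exact: (diag_self_adjoint hip fB sL).
have b0 k : 0 < b k by have /andP[/(lt_le_trans c0)] := bcK k.
have s2 k : s k * s k = (b k)^-1.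
  rewrite /s -expRD -mulrDl (_ : - 2^-1 + - 2^-1 = -1); last by lra.
  by rewrite mulN1r expRN lnK ?posrE.
set Q := S \o add_scalar A gamma \o S in hLambda.
have saAg := self_adjoint_add_scalar gamma hAs.
have saQ : self_adjoint ip Q.
  split.
    apply: bounded_operator_comp saS.1; exact: bounded_operator_comp saS.1 saAg.1.
  by move=> x y; rewrite /Q/= saS.2 saAg.2 saS.2.
have LE : Lambda = add_scalar Q (- nu).
  by apply/funext => x; rewrite -hLambda /add_scalar scaleNr addrK.
have saL : self_adjoint ip Lambda by rewrite LE; exact: self_adjoint_add_scalar.
have pdL : positive_definite ip (add_scalar Lambda nu).
  (* The form at [x] is that of [add_scalar A gamma] at [S x], hence at least [m |S x|^2]; and [|x|
     |S x| >= ip x (S x) >= expR (- L') |x|^2] bounds [|S x|] from below. *)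
  rewrite hLambda; split=> //; have [_ [m m0 hm]] := pdA.
  exists (m * expR (- L') ^+ 2) => [|x]; first by rewrite mulr_gt0// exprn_gt0 ?expR_gt0.
  rewrite /Q/= -saS.2 (le_trans _ (hm (S x)))// -mulrA ler_wpM2l ?(ltW m0)//.
  rewrite -exprMn ler_pXn2r ?nnegrE ?mulr_ge0 ?expR_ge0//.
  have [->|x0] := eqVneq x 0; first by rewrite normr0 mulr0.
  rewrite -(@ler_pM2l _ `|x|) ?normr_gt0//.
  apply: le_trans (cauchy_schwarz hip x (S x)); apply: le_trans (ler_norm _).
  by rewrite mulrCA -expr2 SE; exact: (diag_ge hip fB sL).
have hsL : hilbert_schmidt ip Lambda.
  split; first exact: saL.1.
  exists f => //.
  have [N hN] := hilbert_schmidt_bound_in hip hA hAs fB.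
  pose D := expR L'.
  (* The factors 2 come from [|u + v|^2 <= 2 |u|^2 + 2 |v|^2], with [u] the part from [A] and [v]
     the scalar part on [f k]. *)
  apply: (cvgn_series_nneg (M := 2 * (D ^+ 2) ^+ 2 * N + 2 * (nu / c) ^+ 2 * M)).
    by move=> k; exact: sqr_ge0.
  move=> n.
  apply: (@le_trans _ _ (\sum_(0 <= k < n) (2 * (D ^+ 2) ^+ 2 * `|A (f k)| ^+ 2 +
      2 * (nu / c) ^+ 2 * (b k - mu) ^+ 2))); last first.
    rewrite big_split/= -!mulr_sumr.
    by apply: lerD; apply: ler_wpM2l => //; rewrite mulr_ge0// sqr_ge0.
  apply: ler_sum => k _.
  (* The scalar part is [gamma * s k ^+ 2 - nu = gamma / b k - gamma / mu], which is small with
     [mu - b k]. *)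
  have -> : Lambda (f k) = s k *: S (A (f k)) + (nu / b k * (mu - b k)) *: f k.
    have [_ _ AZ _] := linear_opP hAs.1.1; have [SD _ SZ _] := linear_opP saS.1.1.
    rewrite LE /Q /add_scalar/= {2 3}SE (diag_basis hip fB sL) AZ SD !SZ.
    rewrite scalerA {2}SE (diag_basis hip fB sL) -addrA; congr (_ + _).
    rewrite !scalerA -scalerDl; congr (_ *: _).
    rewrite -mulrA s2 /nu; have := b0 k; have := mu0 => *; field.
    by rewrite !gt_eqF.
  have h1 : `|s k *: S (A (f k))| <= D ^+ 2 * `|A (f k)|.
    rewrite normrZ expr2 -mulrA ler_pM// SE.
    exact: (diag_norm_le hip fB sL).
  have h2 : `|(nu / b k * (mu - b k)) *: f k| <= nu / c * `|b k - mu|.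
    rewrite normrZ (onb_norm hip fB) mulr1 normrM distrC ler_wpM2r//.
    rewrite gtr0_norm ?divr_gt0// ler_wpM2l ?(ltW nu0)// lef_pV2 ?posrE//.
    by have /andP[] := bcK k.
  set u := _ *: _ in h1 *; set v := (nu / b k * (mu - b k)) *: _ in h2 *.
  have h3 : `|u + v| ^+ 2 <= 2 * `|u| ^+ 2 + 2 * `|v| ^+ 2.
    apply: (@le_trans _ _ ((`|u| + `|v|) ^+ 2)).
      by rewrite ler_pXn2r ?nnegrE ?addr_ge0// ler_normD.
    by have := sqr_ge0 (`|u| - `|v|); lra.
  rewrite (le_trans h3)// -2!(mulrA 2) -exprMn; apply: lerD; rewrite ler_wpM2l//.
    by rewrite ler_pXn2r ?nnegrE// (le_trans _ h1).
  rewrite -[(b k - mu) ^+ 2]real_normK ?num_real// -exprMn.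
  by rewrite ler_pXn2r ?nnegrE// (le_trans _ h2).
have [g [t [c1 [K1 [L1 [M1 [[c10 gB Lg tcK] [hM1 lnt powL]]]]]]]] :=
  op_pow_hilbert_schmidt hip hdim hsL saL pdL.
rewrite !powL.
have ab0 : 0 < alpha + beta by exact: addr_gt0.
have hpq' : p * alpha * expR (p * ln nu) = q * beta * expR (- q * ln nu).
  by move: hpq; rewrite /powR gt_eqF.
have [C C0 hC] := power_mean_quadratic K1 halpha hbeta nu0 c10 hpq'.
pose F x := (alpha + beta)^-1 *
    (alpha * expR (p * ln x) + beta * expR (- q * ln x)).
have eL r k : expR (- (`|r| * L1)) <= expR (r * ln (t k)) <= expR (`|r| * L1).
  by rewrite !ler_expR -ler_norml normrM ler_wpM2l.
have eLn r k : `|expR (r * ln (t k))| <= expR (`|r| * L1).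
  by rewrite ger0_norm ?expR_ge0//; have /andP[] := eL r k.
(* The logarithms of the [t k] are bounded by [L1], so the entries of the mean are bounded below by
   [m > 0], which gives positive definiteness. *)
pose m := (alpha + beta)^-1 *
  (alpha * expR (- (`|p| * L1)) + beta * expR (- (`|- q| * L1))).
have m0 : 0 < m.
  by rewrite /m mulr_gt0 ?invr_gt0// addr_gt0// mulr_gt0// expR_gt0.
have Fm k : m <= F (t k).
  rewrite ler_wpM2l ?invr_ge0 ?(ltW ab0)// lerD// ler_wpM2l ?(ltW halpha) ?(ltW hbeta)//.
    by have /andP[] := eL p k.
  by have /andP[] := eL (- q) k.
pose m' := (alpha + beta)^-1 *
  (alpha * expR (`|p| * L1) + beta * expR (`|- q| * L1)).
have Fm' k : `|F (t k)| <= m'.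
  rewrite ger0_norm ?(le_trans (ltW m0))//.
  rewrite ler_wpM2l ?invr_ge0 ?(ltW ab0)// lerD// ler_wpM2l ?(ltW halpha) ?(ltW hbeta)//.
    by have /andP[] := eL p k.
  by have /andP[] := eL (- q) k.
have -> : (fun x => (alpha + beta)^-1 *:
    (alpha *: diag ip g (fun k => expR (p * ln (t k))) x +
     beta *: diag ip g (fun k => expR (- q * ln (t k))) x)) =
    diag ip g (fun k => F (t k)).
  apply/funext => x; apply: (onb_ext gB) => k.
  rewrite ipZr ipDr !ipZr (ip_diag hip gB (eLn p)) (ip_diag hip gB (eLn (- q))).
  by rewrite (ip_diag hip gB Fm') /F; ring.
(* The quadratic estimate turns square-summability of [t k - nu] into absolute summability, that is,
   Hilbert-Schmidt into trace class. *)
have hS n : \sum_(0 <= k < n) `|F (t k) - F nu| <= C * M1.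
  rewrite (@le_trans _ _ (\sum_(0 <= k < n) C * (t k - nu) ^+ 2))//.
    by apply: ler_sum => k _; exact: hC.
  by rewrite -mulr_sumr ler_wpM2l.
have dF k : `|F (t k) - F nu| <= C * M1.
  by rewrite (le_trans _ (hS k.+1))// big_nat_recr//= lerDr sumr_ge0.
exists (diag ip g (fun k => F (t k) - F nu)), (F nu); split.
- exact: (trace_class_diag hip gB hS).
- exact: (diag_self_adjoint hip gB dF).
- apply/funext => x; apply: (onb_ext gB) => k; rewrite /add_scalar ipDr ipZr.
  by rewrite (ip_diag hip gB Fm') (ip_diag hip gB dF) mulrBl subrK.
- split; first exact: (diag_self_adjoint hip gB Fm').
  by exists m => // x; exact: (diag_ge hip gB Fm').
Qed.
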